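(* Let $r\ge 1$, let $a_1,\dots,a_r$ be positive integers, and let $\lambda$ be the self-conjugate partition $$\lambda=\big((a_1+a_2+\cdots+a_r)^{a_1},(a_1+a_2+\cdots+a_{r-1})^{a_2},\ldots,(a_1)^{a_r}\big).$$ Then, for every integer $k\ge 1$, the number $C_k^{\lambda}$ of $\lambda$-plane trees on $k+1$ vertices is $$C_k^{\lambda}=\sum_{\substack{\ell_1,\ldots,\ell_r\ge 0\\ \ell_1+\cdots+\ell_r=k+1}} t(\ell_1,\ldots,\ell_r)\,a_1^{\ell_1}\cdots a_r^{\ell_r},$$ where, writing $\ell_{\le i}=\ell_1+\cdots+\ell_i$ and $\ell_{\ge i}=\ell_i+\cdots+\ell_r$ for $1\le i\le r$, $$t(\ell_1,\ldots,\ell_r)=\frac1k\prod_{j=1}^{r}\binom{\ell_{\ge j}+\ell_{\le r-j+1}-1-\epsilon_j}{\ell_j},\qquad \epsilon_j=\begin{cases}1 & \text{if } j\le\lceil r/2\rceil,\\ 0&\text{otherwise.}\end{cases}$$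
   Context: A partition is a weakly decreasing sequence $\lambda=(\lambda_1\ge\lambda_2\ge\cdots)$ of nonnegative integers, eventually zero; its length $\ell(\lambda)$ is the number of positive parts. The notation $(b_1^{m_1},\dots,b_r^{m_r})$ denotes the partition with $m_i$ parts equal to $b_i$ for each $i$. The partition is identified with its Young diagram $\{(i,j)\in\mathbb{Z}^2:1\le i\le\ell(\lambda),\ 1\le j\le\lambda_i\}$, and it is self-conjugate if this set is invariant under $(i,j)\mapsto(j,i)$. A plane tree is a rooted tree in which the children of every vertex are linearly ordered. For $\lambda$ self-conjugate of length $\ell$, a $\lambda$-plane tree is a pair $(T,c)$, where $T$ is a plane tree with vertex set $V$ and edge set $E$ and $c:V\to\{1,\dots,\ell\}$ satisfies $(c(u),c(v))\in\lambda$ whenever $\{u,v\}\in E$. They are counted up to isomorphism preserving root, order of children, and labels. Binomial coefficients are $\binom{n}{m}=n(n-1)\cdots(n-m+1)/m!$ for integers $n$ and $m\ge0$; in particular $\binom n0=1$ also when $n$ is negative. *)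

(* Defs.v *)
From HB Require Import structures.
From mathcomp Require Import all_boot all_order all_algebra.

Set Implicit Arguments.
Unset Strict Implicit.
Unset Printing Implicit Defensive.

Import GRing.Theory.

(* A partition is the sequence of its positive parts, so its length is [size]. *)
Definition is_partition (lam : seq nat) : bool :=
  sorted geq lam && all (fun x => 0 < x) lam.

(* Rows and columns are numbered from 1. *)
Definition diagram (lam : seq nat) : pred (nat * nat) :=
  fun p => [&& 0 < p.1, 0 < p.2 & p.2 <= nth 0 lam p.1.-1].

Definition self_conjugate (lam : seq nat) : Prop :=
  forall i j, ((i, j) \in diagram lam) = ((j, i) \in diagram lam).

(* A plane tree together with a label at each vertex. The children form a list
   and vertices have no names, so the terms of this type are exactly the
   isomorphism classes of pairs (T, c) with T a plane tree and c : V -> L. *)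
Inductive ltree (L : Type) : Type := Node of L & seq (ltree L).

Section LTree.
Variable L : Type.

Definition root_label (t : ltree L) : L := let: Node x _ := t in x.

Fixpoint nvertices (t : ltree L) : nat :=
  let: Node _ ts := t in (sumn (map nvertices ts)).+1.

(* The pairs (label of the parent, label of the child), one for each edge. *)
Fixpoint edge_labels (t : ltree L) : seq (L * L) :=
  let: Node x ts := t in
  flatten [seq (x, root_label u) :: edge_labels u | u <- ts].

Lemma ltree_ind_all (P : ltree L -> Prop) :
  (forall x ts, foldr (fun u Q => P u /\ Q) True ts -> P (Node x ts)) ->
  forall t, P t.
Proof.
move=> IH; fix rec 1; case=> x ts; apply: IH.
by elim: ts => [|t ts IHts]; split.
Qed.

Fixpoint ltree_encode (t : ltree L) : GenTree.tree L :=
  let: Node x ts := t in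
  GenTree.Node 0 (GenTree.Leaf x :: map ltree_encode ts).

Fixpoint ltree_decode (t : GenTree.tree L) : option (ltree L) :=
  if t is GenTree.Node _ (GenTree.Leaf x :: us)
  then Some (Node x (pmap ltree_decode us)) else None.

Lemma ltree_encodeK : pcancel ltree_encode ltree_decode.
Proof.
elim/ltree_ind_all=> x ts IH /=; congr (Some (Node x _)).
by elim: ts IH => [|t ts IHts] //= [-> /IHts ->].
Qed.

End LTree.

HB.instance Definition _ (L : countType) :=
  Countable.copy (ltree L) (pcan_type (@ltree_encodeK L)).

(* [ltrees L n] lists all trees of height < n whose vertices have at most n
   children; it only serves to show that there are finitely many labelled trees
   on n vertices. *)
Section Enumeration.

Fixpoint lists_of (T : Type) (s : seq T) (n : nat) : seq (seq T) :=
  if n is m.+1 then [::] :: [seq x :: l | x <- s, l <- lists_of s m]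
  else [:: [::]].

Lemma mem_lists_of (T : eqType) (s l : seq T) n :
  size l <= n -> {subset l <= s} -> l \in lists_of s n.
Proof.
elim: n l => [|n IH] [|x l] //=; rewrite ltnS => hl hs.
rewrite inE /=; apply/allpairsP; exists (x, l); split => //=.
  by apply: hs; rewrite mem_head.
by apply: IH => // y hy; apply: hs; rewrite inE hy orbT.
Qed.

Variable L : finType.

Fixpoint ltrees_upto (w h : nat) : seq (ltree L) :=
  if h is g.+1 then
    [seq Node x ts | x <- enum L, ts <- lists_of (ltrees_upto w g) w]
  else [::].

Definition ltrees n := ltrees_upto n n.

Lemma nvertices_gt0 (t : ltree L) : 0 < nvertices t. Proof. by case: t. Qed.

Lemma mem_ltrees_upto w h (t : ltree L) :
  nvertices t <= h -> nvertices t <= w -> t \in ltrees_upto w h.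
Proof.
elim: h t => [|h IH] [x ts] //=; rewrite ltnS => hh hw.
have hmem u : u \in ts -> nvertices u <= sumn (map (@nvertices L) ts).
  elim: (ts) => //= v vs IHv; rewrite inE => /orP[/eqP->|/IHv hv].
    exact: leq_addr.
  exact: leq_trans hv (leq_addl _ _).
apply/allpairsP; exists (x, ts); split; rewrite ?mem_enum //=.
apply: mem_lists_of => [|u /hmem hu]; last first.
  by apply: IH; [apply: leq_trans hu hh | apply: leq_trans hu (ltnW hw)].
have: size ts <= sumn (map (@nvertices L) ts).
  elim: (ts) => //= v vs IHv; rewrite -add1n.
  by rewrite leq_add ?nvertices_gt0.
by move=> hs; apply: leq_trans hs (ltnW hw).
Qed.

Lemma mem_ltrees n (t : ltree L) : nvertices t = n -> t \in ltrees n.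
Proof. by move=> <-; apply: mem_ltrees_upto. Qed.

End Enumeration.

(* A label c in {1, ..., ell} is represented by the ordinal c - 1 : 'I_ell. *)
Definition compatible (lam : seq nat) (i j : 'I_(size lam)) : bool :=
  (i.+1, j.+1) \in diagram lam.

(* Edges are unordered pairs, hence the condition in both directions. *)
Definition is_lambda_plane_tree (lam : seq nat) (t : ltree 'I_(size lam)) : bool :=
  all (fun e => compatible e.1 e.2 && compatible e.2 e.1) (edge_labels t).

Definition lambda_plane_tree (lam : seq nat) (n : nat) : Type :=
  {t : ltree 'I_(size lam) | (nvertices t == n) && is_lambda_plane_tree t}.

Section Finite.
Variables (lam : seq nat) (n : nat).
Notation lpt := (lambda_plane_tree lam n).

HB.instance Definition _ := Countable.on lpt.

Definition lpt_enum : seq lpt := undup (pmap insub (ltrees 'I_(size lam) n)).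

Lemma lpt_enumP : Finite.axiom lpt_enum.
Proof.
apply: Finite.uniq_enumP; first exact: undup_uniq.
move=> t; rewrite mem_undup mem_pmap; apply/mapP; exists (val t).
  by apply: mem_ltrees; case/andP: (valP t) => /eqP.
by rewrite valK.
Qed.

HB.instance Definition _ := isFinite.Build lpt lpt_enumP.

End Finite.

Section Staircase.
Variables (r : nat) (f : 'I_r -> nat).

(* With indices numbered from 1 as f_1, ..., f_r:
   f_1 + ... + f_m and f_m + ... + f_r. *)
Definition sum_le (m : nat) : nat := \sum_(i < r | i.+1 <= m) f i.
Definition sum_ge (m : nat) : nat := \sum_(i < r | m <= i.+1) f i.

Definition staircase : seq nat :=
  flatten [seq nseq (f i) (sum_le (r - i.+1 + 1)) | i <- enum 'I_r].

Hypothesis f_gt0 : forall i, 0 < f i.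

Let g (m : nat) : nat := if insub m is Some i then f i else 0.
Let h (m : nat) : nat := sum_le (r - m).

Lemma leq_sum_le m n : m <= n -> sum_le m <= sum_le n.
Proof.
move=> le_mn; rewrite /sum_le big_mkcond [leqRHS]big_mkcond leq_sum //= => i _.
by case: ifP => // le_im; rewrite (leq_trans le_im le_mn).
Qed.

Lemma sum_leE m : m <= r -> sum_le m = \sum_(0 <= j < m) g j.
Proof.
move=> le_mr; rewrite big_mkord (big_ord_widen_cond r xpredT) //.
by apply: eq_bigr => i _; rewrite /g insubT //= => lt_ir; congr f; apply: val_inj.
Qed.

Lemma staircaseE : staircase = flatten [seq nseq (g m) (h m) | m <- iota 0 r].
Proof.
rewrite /staircase -val_enum_ord -map_comp; congr flatten; apply: eq_map => i /=.
rewrite /g /h insubT //= => lt_ir.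
by rewrite addn1 subnSK //; congr (nseq (f _) _); apply: val_inj.
Qed.

Lemma blocksP (s n x y : nat) :
  reflect (exists i, [/\ s <= i < s + n, x < \sum_(s <= j < i.+1) g j & y < h i])
    (y < nth 0 (flatten [seq nseq (g m) (h m) | m <- iota s n]) x).
Proof.
elim: n s x => [|n IH] s x /=.
  by rewrite nth_nil ltn0; constructor => -[i []]; rewrite addn0; case: ltngtP.
rewrite nth_cat size_nseq; case: (ltnP x (g s)) => [lt_xg|le_gx].
  rewrite nth_nseq lt_xg; apply: (iffP idP) => [lt_yh|[i [/andP[le_si _] _]]].
    by exists s; rewrite leqnn -addSnnS leq_addr big_nat1.
  by move=> hy; apply: leq_trans hy _; apply: leq_sum_le; apply: leq_sub2l.
apply: (iffP (IH s.+1 _)) => -[i [/andP[le_si lt_in] hx hy]]; exists i.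
  rewrite (ltnW le_si) addnS -addSn lt_in; split=> //.
  by rewrite big_ltn ?ltnS ?(ltnW le_si) // -ltn_subLR.
have lt_si : s < i.
  rewrite ltn_neqAle le_si andbT; apply: contraTneq hx => <-.
  by rewrite big_nat1 -leqNgt.
rewrite lt_si addSnnS lt_in; split=> //.
by rewrite ltn_subLR // -big_ltn // ltnS.
Qed.

Lemma staircaseP x y :
  reflect (exists i, [/\ i < r, x < sum_le i.+1 & y < sum_le (r - i)])
    (y < nth 0 staircase x).
Proof.
rewrite staircaseE; apply: (iffP (blocksP 0 r x y)) => -[i].
  by case=> /andP[_ ltir] hx hy; exists i; rewrite sum_leE.
by case=> ltir hx hy; exists i; rewrite -sum_leE.
Qed.

Lemma staircase_partition : is_partition staircase.
Proof.
apply/andP; split.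
  apply/(sortedP 0) => x _; rewrite /= leqNgt; apply/negP => /staircaseP[i [? hx hy]].
  suff: nth 0 staircase x < nth 0 staircase x by rewrite ltnn.
  by apply/staircaseP; exists i; rewrite (ltnW hx).
apply/allP => y /flattenP[_ /mapP[i _ ->]] /nseqP[-> _].
rewrite /sum_le (bigD1 (Ordinal (leq_ltn_trans (leq0n i) (ltn_ord i)))) /=.
  by rewrite addn_gt0 f_gt0.
by rewrite addn1.
Qed.

Lemma staircase_self_conjugate : self_conjugate staircase.
Proof.
suff sub i j : (i, j) \in diagram staircase -> (j, i) \in diagram staircase.
  by move=> i j; apply/idP/idP; apply: sub.
rewrite !unfold_in /=; case: i j => [|i] [|j] //= /staircaseP[m [ltmr hi hj]].
apply/staircaseP; exists (r - m.+1); rewrite subnSK // subKn //.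
by rewrite leq_subr.
Qed.

End Staircase.

Local Open Scope ring_scope.

(* n (n - 1) ... (n - m + 1) / m! for a possibly negative integer n. *)
Definition binz (n : int) (m : nat) : rat :=
  (\prod_(i < m) (n - i%:Z)%:~R) / (m`!)%:R.

Definition eps (r j : nat) : nat := (j <= uphalf r)%N.

Definition tcoef (r k : nat) (l : 'I_r -> nat) : rat :=
  k%:R^-1 *
  \prod_(j < r) binz ((sum_ge l j.+1)%:Z + (sum_le l (r - j.+1 + 1))%:Z
                        - 1 - (eps r j.+1)%:Z)
                     (l j).

(* Main.v *)
Require Import Defs.
From HB Require Import structures.
From mathcomp Require Import all_boot all_order all_algebra.
From mathcomp Require Import boolp.
From mathcomp Require Import ring zify.

(* Split the labels into r blocks of sizes a_1, ..., a_r, so that blocks i and j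
   are compatible iff i + j <= r + 1. Let 1 - U_m be the generating series of
   the trees whose root lies in the first m blocks. Then U_0 = 1 and
   (U_m - U_(m+1)) U_(r-m) = a_(m+1) X, and minus the coefficients of y := U_r
   are the numbers sought. Reading these equations in zigzag order
   (a_1, a_r, a_2, a_(r-1), ...), the products U_r U_0, U_1 U_r, U_1 U_(r-1), ...
   become y (1 + d_s X / y) with explicit numbers d_s, and a telescoping
   product of their quotients gives y phi(X / y) = 1, where phi is a product of
   powers of the linear polynomials L_s = 1 + d_s X. Lagrange inversion yields
   k [X^(k+1)] y = - [X^(k+1)] phi^k. Finally phi^k is expanded by the binomial
   series in one label variable at a time, starting from the last one in zigzag
   order: L_(s+1)^e = sum_j binz e j (c_s X)^j L_s^(e - j). *)

Set Implicit Arguments.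
Unset Strict Implicit.
Unset Printing Implicit Defensive.

Import GRing.Theory Num.Theory.

Local Open Scope ring_scope.

(** * Formal power series *)

Record fps (R : Type) := Fps { fcoef : nat -> R }.

Arguments fcoef : simpl never.

Lemma fpsP (R : Type) (a b : fps R) : fcoef a =1 fcoef b -> a = b.
Proof. by case: a b => [a] [b] /funext /= eq_ab; congr Fps; exact: eq_ab. Qed.

HB.instance Definition _ (R : Type) := gen_eqMixin (fps R).
HB.instance Definition _ (R : Type) := gen_choiceMixin (fps R).

Section FpsRing.
Variable R : comNzRingType.
Implicit Types (a b c : fps R) (p q : {poly R}).

Definition fadd a b := Fps (fun n => fcoef a n + fcoef b n).
Definition fopp a := Fps (fun n => - fcoef a n).
Definition fps_of_poly p := Fps (fun n => p`_n).
Lemma fcoef_poly p n : fcoef (fps_of_poly p) n = p`_n. Proof. by []. Qed.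

Definition fmul a b :=
  Fps (fun n => \sum_(i < n.+1) fcoef a i * fcoef b (n - i)%N).
Definition ftrunc n a : {poly R} := \poly_(i < n) fcoef a i.

(** Low coefficients of a product see only low coefficients of the factors; through this, [fmul]
    inherits its ring laws from [{poly R}]. *)
Lemma fcoef_mul_trunc n m a b : (m < n)%N ->
  fcoef (fmul a b) m = (ftrunc n a * ftrunc n b)`_m.
Proof.
move=> lt_mn; rewrite coefM; apply: eq_bigr => i _.
rewrite !coef_poly (leq_ltn_trans (leq_subr _ _) lt_mn).
by rewrite (leq_trans (ltn_ord i) lt_mn).
Qed.

Lemma fmulA : associative fmul.
Proof.
have aux a b c n :
    fcoef (fmul a (fmul b c)) n = (ftrunc n.+1 a * (ftrunc n.+1 b * ftrunc n.+1 c))`_n.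
  rewrite (fcoef_mul_trunc (n := n.+1)) // !coefM; apply: eq_bigr => i _; congr (_ * _).
  by rewrite [LHS]coef_poly ltnS leq_subr (fcoef_mul_trunc (n := n.+1)) ?ltnS ?leq_subr.
move=> a b c; apply: fpsP => n; rewrite aux.
rewrite [RHS](fcoef_mul_trunc (n := n.+1)) // mulrA !coefM.
apply: eq_bigr => i _; congr (_ * _).
by rewrite [RHS]coef_poly ltn_ord (fcoef_mul_trunc (n := n.+1)).
Qed.

Lemma fmulC : commutative fmul.
Proof.
by move=> a b; apply: fpsP => n; rewrite !(fcoef_mul_trunc (n := n.+1)) // mulrC.
Qed.

Fact faddA : associative fadd.
Proof. by move=> a b c; apply: fpsP => n; apply: addrA. Qed.
Fact faddC : commutative fadd.
Proof. by move=> a b; apply: fpsP => n; apply: addrC. Qed.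
Fact fadd0 : left_id (Fps (fun=> 0)) fadd.
Proof. by move=> a; apply: fpsP => n; apply: add0r. Qed.
Fact faddN : left_inverse (Fps (fun=> 0)) fopp fadd.
Proof. by move=> a; apply: fpsP => n; apply: addNr. Qed.

HB.instance Definition _ := GRing.isZmodule.Build (fps R) faddA faddC fadd0 faddN.

Fact fmul1 : left_id (fps_of_poly 1) fmul.
Proof.
move=> a; apply: fpsP => n; rewrite /fmul {1}/fcoef big_ord_recl big1 => [|i _];
  rewrite fcoef_poly coef1.
  by rewrite mul1r subn0 addr0.
by rewrite mul0r.
Qed.
Fact fmulDl : left_distributive fmul fadd.
Proof.
by move=> a b c; apply: fpsP => n; rewrite /fcoef /= -big_split;
  apply: eq_bigr => i _; rewrite mulrDl.
Qed.
Fact fone_neq0 : fps_of_poly 1 != 0.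
Proof.
apply/eqP => /(congr1 (fun a => fcoef a 0)); rewrite /fcoef /= coef1 => /eqP.
by rewrite oner_eq0.
Qed.

HB.instance Definition _ :=
  GRing.Zmodule_isComNzRing.Build (fps R) fmulA fmulC fmul1 fmulDl fone_neq0.

Lemma fcoefM a b n : fcoef (a * b) n = \sum_(i < n.+1) fcoef a i * fcoef b (n - i)%N.
Proof. by []. Qed.

Lemma fcoefD n a b : fcoef (a + b) n = fcoef a n + fcoef b n. Proof. by []. Qed.
Lemma fcoefB n a b : fcoef (a - b) n = fcoef a n - fcoef b n. Proof. by []. Qed.
Lemma fcoef1 n : fcoef (1 : fps R) n = (n == 0%N)%:R. Proof. exact: coef1. Qed.
Lemma fcoef_sum n I (r : seq I) P (F : I -> fps R) :
  fcoef (\sum_(i <- r | P i) F i) n = \sum_(i <- r | P i) fcoef (F i) n.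
Proof. exact: (big_morph (fun a => fcoef a n)). Qed.
Lemma fcoefMn n a m : fcoef (a *+ m) n = fcoef a n *+ m.
Proof. by elim: m => [|m IH] //; rewrite !mulrS fcoefD IH. Qed.

Fact fps_of_poly_is_additive : additive fps_of_poly.
Proof. by move=> p q; apply: fpsP => n; apply: coefB. Qed.
Fact fps_of_poly_is_monoid_morphism : monoid_morphism fps_of_poly.
Proof. by split=> // p q; apply: fpsP => n; apply: coefM. Qed.
HB.instance Definition _ :=
  GRing.isZmodMorphism.Build {poly R} (fps R) fps_of_poly fps_of_poly_is_additive.
HB.instance Definition _ :=
  GRing.isMonoidMorphism.Build {poly R} (fps R) fps_of_poly fps_of_poly_is_monoid_morphism.

Definition fC (x : R) : fps R := fps_of_poly x%:P.
HB.instance Definition _ := GRing.RMorphism.copy fC (fps_of_poly \o polyC).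

Lemma fcoefC x n : fcoef (fC x) n = if n == 0%N then x else 0.
Proof. exact: coefC. Qed.

Definition fX : fps R := fps_of_poly 'X.

Lemma fcoefCM x a n : fcoef (fC x * a) n = x * fcoef a n.
Proof.
rewrite fcoefM big_ord_recl big1 => [|i _]; rewrite fcoefC /=.
  by rewrite subn0 addr0.
by rewrite mul0r.
Qed.

Lemma fcoefXnM a m n :
  fcoef (fX ^+ m * a) n = if (n < m)%N then 0 else fcoef a (n - m)%N.
Proof.
rewrite -rmorphXn (fcoef_mul_trunc (n := n.+1)) //.
have -> : ftrunc n.+1 (fps_of_poly 'X^m) = if (n < m)%N then 0 else 'X^m.
  apply/polyP => i; rewrite coef_poly fcoef_poly coefXn.
  by case: ltnP => [?|?]; case: ltnP => [?|?]; rewrite ?coef0 ?coefXn //;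
    rewrite (_ : (i == m) = false) //; lia.
case: ltnP => [_|le_mn]; first by rewrite mul0r coef0.
by rewrite coefXnM ltnNge le_mn coef_poly ltnS leq_subr.
Qed.

Lemma fcoefXM a n : fcoef (fX * a) n = if n is m.+1 then fcoef a m else 0.
Proof. by case: n => [|n]; rewrite -[fX]expr1 fcoefXnM //= subn1. Qed.

Lemma fcoefM0 a b : fcoef (a * b) 0 = fcoef a 0 * fcoef b 0.
Proof. by rewrite fcoefM big_ord_recl big_ord0 addr0. Qed.

(** Invertibility is decided classically and the inverse is chosen; [fps_unit_coef0] gives a
    concrete sufficient condition. *)
Definition fps_unit : pred (fps R) := fun a => `[< exists b, b * a = 1 >].
Definition fps_inv a : fps R :=
  if pselect (exists b, b * a = 1) is left h then projT1 (cid h) else a.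

Fact fps_mulVr : {in fps_unit, left_inverse 1 fps_inv *%R}.
Proof.
by move=> a /asboolP h; rewrite /fps_inv; case: pselect => // h'; case: cid.
Qed.
Fact fps_unitP a b : b * a = 1 -> fps_unit a.
Proof. by move=> h; apply/asboolP; exists b. Qed.
Fact fps_inv_out : {in [predC fps_unit], fps_inv =1 id}.
Proof. by move=> a /asboolP h; rewrite /fps_inv; case: pselect. Qed.

HB.instance Definition _ :=
  GRing.ComNzRing_hasMulInverse.Build (fps R) fps_mulVr fps_unitP fps_inv_out.

(* The substitution X := X v in a. *)
Definition fcomp (v a : fps R) : fps R :=
  Fps (fun n => \sum_(i < n.+1) fcoef a i * fcoef (v ^+ i) (n - i)%N).

Lemma fcoef_comp v a n :
  fcoef (fcomp v a) n = \sum_(i < n.+1) fcoef a i * fcoef (v ^+ i) (n - i)%N.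
Proof. by []. Qed.

Lemma fcomp_poly v p :
  fcomp v (fps_of_poly p) = \sum_(i < size p) fC p`_i * (fX * v) ^+ i.
Proof.
apply: fpsP => n; rewrite fcoef_sum fcoef_comp.
pose G i := p`_i * (if (n < i)%N then 0 else fcoef (v ^+ i) (n - i)%N).
transitivity (\sum_(i < n.+1) G i).
  by apply: eq_bigr => i _; rewrite /G ltnNge -ltnS ltn_ord.
transitivity (\sum_(i < size p) G i); last first.
  by apply: eq_bigr => i _; rewrite fcoefCM exprMn fcoefXnM.
rewrite -!(big_mkord xpredT G).
(* [G] vanishes above [n] and from [size p] on, so both sums extend to one common range. *)
have widen m : (m <= maxn n.+1 (size p))%N ->
    (forall i, (m <= i)%N -> G i = 0) ->
    \sum_(0 <= i < m) G i = \sum_(0 <= i < maxn n.+1 (size p)) G i.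
  move=> le_m G0; rewrite [RHS](big_cat_nat (n := m)) //=.
  rewrite [X in _ = _ + X]big_nat_cond [X in _ = _ + X]big1 ?addr0 //.
  by move=> i /andP[/andP[/G0]].
rewrite !widen ?leq_maxl ?leq_maxr // /G => i.
  by move=> ?; rewrite nth_default // mul0r.
by move=> ->; rewrite mulr0.
Qed.

Lemma eq_fcomp v a b n : (forall i, (i <= n)%N -> fcoef a i = fcoef b i) ->
  fcoef (fcomp v a) n = fcoef (fcomp v b) n.
Proof.
by move=> eq_ab; rewrite !fcoef_comp; apply: eq_bigr => i _; rewrite eq_ab // -ltnS.
Qed.

Lemma eq_fcoefM n (a a' b : fps R) : (forall i, (i <= n)%N -> fcoef a i = fcoef a' i) ->
  fcoef (a * b) n = fcoef (a' * b) n.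
Proof.
by move=> eqa; rewrite !fcoefM; apply: eq_bigr => i _; rewrite eqa // -ltnS.
Qed.

Lemma fcoef_trunc n a i : (i <= n)%N ->
  fcoef a i = fcoef (fps_of_poly (ftrunc n.+1 a)) i.
Proof. by move=> le_in; rewrite fcoef_poly coef_poly ltnS le_in. Qed.

(** Coefficients of [a] above [n] do not reach degree [n], so [a] may be replaced by its truncation,
    for which [fcomp] is a finite sum of powers. *)
Lemma fcoef_fcompM v a b n :
  fcoef (fcomp v a * b) n =
  \sum_(i < n.+1) fcoef a i * fcoef (v ^+ i * b) (n - i)%N.
Proof.
transitivity (fcoef (fcomp v (fps_of_poly (ftrunc n.+1 a)) * b) n).
  apply: eq_fcoefM => i le_in; apply: eq_fcomp => j le_ji.
  exact/fcoef_trunc/(leq_trans le_ji).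
rewrite fcomp_poly mulr_suml fcoef_sum.
have sz : (size (ftrunc n.+1 a) <= n.+1)%N by exact: size_poly.
rewrite -(big_mkord xpredT (fun i => fcoef (fC (ftrunc n.+1 a)`_i * (fX * v) ^+ i * b) n)).
rewrite (big_nat_widen _ _ n.+1) // big_mkord big_mkcond; apply: eq_bigr => i _.
have -> : fcoef a i = (ftrunc n.+1 a)`_i by rewrite coef_poly ltn_ord.
rewrite andTb; case: ltnP => [_|le_i]; last by rewrite nth_default // mul0r.
by rewrite -mulrA fcoefCM exprMn -mulrA fcoefXnM ltnNge -ltnS ltn_ord.
Qed.

Fact fcomp_is_additive v : additive (fcomp v).
Proof.
move=> a b; apply: fpsP => n; rewrite fcoefB !fcoef_comp -sumrB; apply: eq_bigr => i _.
by rewrite mulrBl.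
Qed.
Fact fcomp_is_monoid_morphism v : monoid_morphism (fcomp v).
Proof.
split=> [|a b]; apply: fpsP => n.
  rewrite fcoef_comp big_ord_recl big1 => [|i _]; rewrite fcoef1 /=.
    by rewrite expr0 subn0 fcoef1 mul1r addr0.
  by rewrite mul0r.
rewrite fcoef_fcompM fcoef_comp.
under [LHS]eq_bigr => m _ do rewrite mulr_suml.
(* Grouping the terms [H i j] by i + j gives one side, grouping them by i the other. *)
pose H (i j : nat) := fcoef a i * fcoef b j * fcoef (v ^+ (i + j)) (n - (i + j)).
transitivity (\sum_(m < n.+1) \sum_(i < n.+1 | (i <= m)%N) H i (m - i)%N).
  apply: eq_bigr => m _; rewrite (big_ord_widen_cond n.+1 xpredT
    (fun i => fcoef a i * fcoef b (m - i)%N * fcoef (v ^+ m) (n - m)%N)) ?ltn_ord //.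
  apply: eq_bigr => i /= le_im; rewrite /H subnKC // ?mulrA //.
rewrite (exchange_big_dep xpredT) //; apply: eq_bigr => i _.
rewrite mulrC [X in _ = X * _](_ : _ = fcoef (fcomp v b * v ^+ i) (n - i));
  last by rewrite mulrC.
rewrite fcoef_fcompM mulr_suml.
rewrite -(big_mkord (fun m => i <= m)%N (fun m => H i (m - i)%N)).
rewrite (big_cat_nat (n := i)) //= ?(ltnW (ltn_ord i)) //.
rewrite [X in X + _]big_nat_cond [X in X + _]big1 ?add0r; last first.
  by move=> m; case/andP => /andP[_ ?] ?; lia.
rewrite -{1}[nat_of_ord i]add0n big_addn subSn -1?ltnS // big_mkord.
under [LHS]eq_bigl => m do rewrite leq_addl.
by apply: eq_bigr => m _; rewrite /H addnK -exprD -subnDA [(m + i)%N]addnC [RHS]mulrC mulrA.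
Qed.
HB.instance Definition _ v :=
  GRing.isZmodMorphism.Build (fps R) (fps R) (fcomp v) (fcomp_is_additive v).
HB.instance Definition _ v :=
  GRing.isMonoidMorphism.Build (fps R) (fps R) (fcomp v) (fcomp_is_monoid_morphism v).

Lemma fcomp_polyX v : fcomp v fX = fX * v.
Proof.
rewrite fcomp_poly size_polyX big_ord_recl big_ord1 /= !coefX /=.
by rewrite rmorph0 rmorph1 mul0r add0r mul1r expr1.
Qed.

Lemma fcompC v x : fcomp v (fC x) = fC x.
Proof.
apply: fpsP => n; rewrite fcoef_comp big_ord_recl big1 => [|i _]; rewrite fcoefC /=.
  by rewrite expr0 subn0 fcoef1 addr0 fcoefC; case: (n) => [|m] //=; rewrite ?mulr1 ?mulr0.
by rewrite mul0r.
Qed.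

(** Such a series is 1 - X v for some v, the image of 1 - X under the ring morphism [fcomp v]; the
    geometric series inverts 1 - X. *)
Lemma fps_unit_coef0 a : fcoef a 0 = 1 -> a \is a GRing.unit.
Proof.
move=> a0; pose geo : fps R := Fps (fun=> 1).
pose v := Fps (fun n => - fcoef a n.+1).
have geoK : geo * (1 - fX) = 1.
  apply: fpsP => n; rewrite mulrBr mulr1 fcoefB [geo * _]mulrC fcoefXM fcoef1.
  by case: n => [|n]; rewrite /= ?subr0 ?subrr.
have def_a : a = fcomp v (1 - fX).
  rewrite rmorphB /= rmorph1 fcomp_polyX; apply: fpsP => n.
  by rewrite fcoefB fcoef1 fcoefXM; case: n => [|n]; rewrite ?subr0 ?a0 //= opprK add0r.
by apply/unitrPr; exists (fcomp v geo); rewrite def_a -rmorphM mulrC geoK rmorph1.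
Qed.

(** The Euler operator X d/dX, a derivation that does not shift indices. *)
Definition theta a := Fps (fun n => fcoef a n *+ n).

Lemma fcoef_theta a n : fcoef (theta a) n = fcoef a n *+ n. Proof. by []. Qed.

Lemma thetaM a b : theta (a * b) = theta a * b + a * theta b.
Proof.
apply: fpsP => n; rewrite fcoefD !fcoefM /= fcoef_theta !fcoefM -sumrMnl -big_split.
apply: eq_bigr => i _ /=; rewrite !fcoef_theta.
by rewrite mulrnAl mulrnAr -mulrnDr subnKC // -ltnS.
Qed.

Lemma thetaX a n : theta (a ^+ n.+1) = (a ^+ n * theta a) *+ n.+1.
Proof.
elim: n => [|n IH]; first by rewrite expr1 expr0 mul1r.
by rewrite exprS thetaM IH mulrnAr mulrA -exprS [theta a * _]mulrC -mulrS.
Qed.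

End FpsRing.
Arguments fX {R}.

(** * Lagrange inversion *)

Section Lagrange.
Variable R : numFieldType.
Implicit Types y phi : fps R.

(** Since phi(X / y) = y^(-1), the series y - theta y equals phi^k(X / y) times y^k (y - theta y).
    In degree k + 1 the i-th coefficient of phi^k is multiplied by [X^(k+1-i)] y^(k-i) (y - theta
    y), which is zero for i <= k. *)
Lemma lagrange_inversion y phi k : fcoef y 0 = 1 ->
  y * fcomp y^-1 phi = 1 ->
  k%:R * fcoef y k.+1 = - fcoef (phi ^+ k) k.+1.
Proof.
move=> y0 y_phi; have yU := fps_unit_coef0 y0.
have yVphi : y^-1 = fcomp y^-1 phi by apply: (mulrI yU); rewrite divrr.
have eq1 : y - theta y = fcomp y^-1 (phi ^+ k) * (y ^+ k * (y - theta y)).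
  by rewrite rmorphXn /= -yVphi mulrA -exprMn mulVr // expr1n mul1r.
have := congr1 (fun a => fcoef a k.+1) eq1.
rewrite fcoefB fcoef_theta fcoef_fcompM big_ord_recr /= subnn big1 => [|i _]; last first.
  have le_ik : (i <= k)%N by rewrite -ltnS.
  have -> : y ^+ k = y ^+ i * y ^+ (k - i) by rewrite -exprD subnKC.
  rewrite !mulrA -exprMn mulVr // expr1n mul1r.
  rewrite subSn //; set m := (k - i)%N.
  (* (m + 1) y^m theta y is theta (y^(m+1)), and in degree m + 1 [theta] multiplies by m + 1, so the
     two contributions cancel. *)
  have : m.+1%:R * fcoef (y ^+ m * (y - theta y)) m.+1 = 0.
    rewrite mulrBr -exprSr fcoefB mulrBr !mulr_natl -[X in _ - X]fcoefMn -thetaX.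
    by rewrite fcoef_theta subrr.
  by move/eqP; rewrite mulf_eq0 pnatr_eq0 /= => /eqP ->; rewrite mulr0.
(* Only i = k + 1 remains; its factor is the constant term of 1 - y^(-1) theta y, which is 1. *)
rewrite mulrA exprS -[_ * _ * y ^+ k]mulrA -exprMn mulVr // expr1n mulr1 mulrBr mulVr //.
rewrite fcoefB fcoef1 fcoefM0 fcoef_theta mulr0n mulr0 subr0 mulr1 add0r => <-.
by rewrite opprB mulrS addrAC subrr add0r mulr_natl.
Qed.

End Lagrange.

(** * Binomial series *)

Lemma binz0 n : binz n 0 = 1.
Proof. by rewrite /binz big_ord0 divr1. Qed.

Lemma binz_pascal n m : binz (n + 1) m.+1 = binz n m.+1 + binz n m.
Proof.
have fact_neq0 i : i`!%:R != 0 :> rat by rewrite pnatr_eq0 -lt0n fact_gt0.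
rewrite /binz big_ord_recl [X in _ = X / _ + _]big_ord_recr /= subr0 factS natrM.
have bumpE (i : 'I_m) : n + 1 - (bump 0 i)%:Z = n - i%:Z.
  by rewrite /bump leq0n add1n intS; ring.
under eq_bigr do rewrite bumpE.
set P := \prod_(i < m) _; rewrite !rmorphD rmorphN /=.
have := fact_neq0 m; have : m.+1%:R != 0 :> rat by rewrite pnatr_eq0.
by rewrite -[m.+1%:R]natr1 => *; field; apply/andP.
Qed.

Lemma binzN n m : binz (- n) m = (-1) ^+ m * binz (n + m%:Z - 1) m.
Proof.
rewrite /binz mulrA; congr (_ / _).
rewrite [X in _ = _ * X](reindex_inj rev_ord_inj) /=.
rewrite -[in X in X * _](card_ord m) -prodr_const -big_split; apply: eq_bigr => i _.
rewrite /= mulN1r -rmorphN; congr (_%:~R) => /=.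
by have := ltn_ord i; lia.
Qed.

(** By Pascal's rule, passing from m to m + 1 multiplies [Fps (binz m)] by 1 + X; as 1 + X is a
    unit, induction runs both ways from exponent 0. *)
Lemma expr1Xz (n : int) : (1 + fX) ^ n = Fps (binz n).
Proof.
have XU : (1 + fX : fps rat) \is a GRing.unit.
  by apply: fps_unit_coef0; rewrite fcoefD fcoef1 fcoef_poly coefX addr0.
have pascal m : Fps (binz (m + 1)) = Fps (binz m) * (1 + fX).
  apply: fpsP => -[|i]; rewrite mulrDr mulr1 fcoefD [_ * fX]mulrC fcoefXM.
    by rewrite /fcoef !binz0 addr0.
  exact: binz_pascal.
elim/int_rect: n => [|n IH|n IH].
- rewrite expr0z; apply: fpsP => -[|i]; rewrite fcoef1 /fcoef ?binz0 //=.
  by rewrite /binz big_ord_recl /= subr0 mul0r mul0r.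
- by rewrite -addn1 PoszD exprzDr // IH expr1z pascal.
apply: (mulIr XU); rewrite -pascal -[X in _ * X]expr1z -exprzDr //.
by rewrite (_ : - n.+1%:Z + 1 = - n%:Z) //; lia.
Qed.

(** L + cX = L (1 + X c / L), where the second factor is the image of 1 + X under [fcomp] at c / L;
    the binomial series is then substituted. *)
Lemma fcoef_exprz_addX (L h : fps rat) c (e : int) N : L \is a GRing.unit ->
  fcoef ((L + fX * fC c) ^ e * h) N =
  \sum_(j < N.+1) binz e j * c ^+ j * fcoef (L ^ (e - j%:Z) * h) (N - j).
Proof.
move=> LU; have XU : (1 + fX : fps rat) \is a GRing.unit.
  by apply: fps_unit_coef0; rewrite fcoefD fcoef1 fcoef_poly coefX addr0.
pose v := fC c / L.
have -> : L + fX * fC c = L * fcomp v (1 + fX).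
  rewrite rmorphD rmorph1 /= fcomp_polyX mulrDr mulr1 /v mulrCA.
  by rewrite [L * (_ / _)]mulrC mulrVK.
rewrite (exprMz_comm _ LU _ (mulrC _ _)) ?rmorph_unit // -rmorphXz //= expr1Xz -mulrA mulrCA.
rewrite fcoef_fcompM; apply: eq_bigr => j _; rewrite -mulrA; congr (_ * _).
rewrite exprMn -rmorphXn -mulrA fcoefCM exprVn; congr (_ * fcoef _ _).
by rewrite exprzDr // -exprnN mulrA [_^-1 * _]mulrC.
Qed.

(** * Expanding powers of phi, one variable at a time *)

Section Chain.
Variables (c : nat -> rat) (k : nat).

(** The linear polynomial L_n, with d_n written as a sum of increments c_i. *)
Definition chain n : fps rat := 1 + fX * fC (\sum_(i < n) c i).

(** For n = r this is phi. The quotients enter alternately inverted (even s) and direct (odd s). *)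
Definition chain_prod n :=
  \prod_(s < n) (chain s.+1 / chain s) ^ ((-1) ^+ s.+1 : int).

Lemma chain_unit n : chain n \is a GRing.unit.
Proof.
by apply: fps_unit_coef0; rewrite fcoefD fcoef1 fcoefXM addr0.
Qed.

Lemma chainS n : chain n.+1 = chain n + fX * fC (c n).
Proof. by rewrite /chain big_ord_recr rmorphD mulrDr addrA. Qed.

(** With eps = (-1)^(n+1), L_(n+1) has total exponent eps k + e. After its expansion, eps k cancels
    against the power of L_n in the last quotient, which leaves the same shape with e - j in place
    of e. *)
Lemma fcoef_chain_prodS n (e : int) N :
  fcoef (chain_prod n.+1 ^+ k * chain n.+1 ^ e) N =
  \sum_(j < N.+1) binz ((-1) ^+ n.+1 * k%:Z + e) j * c n ^+ j *
    fcoef (chain_prod n ^+ k * chain n ^ (e - j%:Z)) (N - j).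
Proof.
rewrite /chain_prod big_ord_recr /= -/(chain_prod n); set eps := (-1) ^+ n.+1.
have -> : (chain_prod n * (chain n.+1 / chain n) ^ eps) ^+ k * chain n.+1 ^ e =
    chain n.+1 ^ (eps * k%:Z + e) * (chain n ^ (- (eps * k%:Z)) * chain_prod n ^+ k).
  rewrite exprMn [(_ ^ eps) ^+ k]exprnP exprz_exp exprMz_comm ?unitrV ?chain_unit //;
    last exact: mulrC.
  rewrite exprz_inv.
  by rewrite exprzDr ?chain_unit //; ring.
rewrite chainS fcoef_exprz_addX ?chain_unit //; apply: eq_bigr => j _.
congr (_ * fcoef _ _); rewrite mulrA -exprzDr ?chain_unit // mulrC.
congr (_ * _ ^ _).
by ring.
Qed.

End Chain.

Lemma sum_ffun_recr (R : comNzRingType) n K (F : {ffun 'I_n.+1 -> 'I_K} -> R)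
    (N : nat) :
  \sum_(l : {ffun 'I_n.+1 -> 'I_K} | (\sum_i l i)%N == N) F l =
  \sum_(j < K) \sum_(l : {ffun 'I_n -> 'I_K} | (\sum_i l i + j)%N == N)
     F [ffun i => if unlift ord_max i is Some i' then l i' else j].
Proof.
rewrite pair_big_dep /=.
pose h (p : 'I_K * {ffun 'I_n -> 'I_K}) : {ffun 'I_n.+1 -> 'I_K} :=
  [ffun i => if unlift ord_max i is Some i' then p.2 i' else p.1].
rewrite (reindex h) /=; last first.
  exists (fun l => (l ord_max, [ffun i => l (lift ord_max i)])) => [[j l] _|l _].
    rewrite /h ffunE unlift_none; congr pair; apply/ffunP => i.
    by rewrite !ffunE liftK.
  apply/ffunP => i; rewrite ffunE.
  by case: unliftP => [i' ->|->] //=; rewrite ffunE.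
apply: eq_bigl => -[j l]; rewrite /= big_ord_recr /= ffunE unlift_none.
congr (_ + _ == _)%N; apply: eq_bigr => i _.
rewrite ffunE (_ : widen_ord _ i = lift ord_max i) ?liftK //.
by apply: val_inj; rewrite [RHS]lift_max.
Qed.

(** Unrolls a recursion that extracts the last variable first: T accumulates the variables already
    extracted, N is the total still to be distributed, and N < K makes the range ['I_K] lossless. *)
Lemma iterated_sum_ffun (R : comNzRingType) (w : nat -> nat -> nat -> R)
    (G : nat -> nat -> nat -> R) K :
  (forall T N, G 0%N T N = (N == 0%N)%:R) ->
  (forall n T N, G n.+1 T N =
     \sum_(j < N.+1) w n T j * G n (T + j)%N (N - j)%N) ->
  forall n T N, (N < K)%N ->
  G n T N = \sum_(l : {ffun 'I_n -> 'I_K} | (\sum_i l i)%N == N)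
     \prod_(s < n) w s (T + \sum_(t < n | (s < t)%N) l t)%N (l s).
Proof.
move=> G0 GS; elim=> [|n IH] T N lt_NK.
  rewrite G0 (eq_bigl (fun=> N == 0%N)) => [|l]; last by rewrite big_ord0 eq_sym.
  case: eqP => _; last by rewrite big_pred0_eq.
  rewrite (eq_bigr (fun=> 1)) => [|l _]; last by rewrite big_ord0.
  by rewrite sumr_const card_ffun !card_ord.
rewrite GS sum_ffun_recr.
rewrite (big_ord_widen K (fun j => w n T j * G n (T + j)%N (N - j)%N)) // big_mkcond.
apply: eq_bigr => j _; case: ifP => [le_jN|/negbT gt_jN]; last first.
  rewrite big_pred0 // => l; apply/eqP => h; case/negP: gt_jN.
  by rewrite ltnS -h leq_addl.
rewrite IH ?(leq_ltn_trans (leq_subr _ _)) // mulr_sumr.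
apply: eq_big => [l|l _].
  by rewrite -(eqn_add2r j) subnK.
have widenE i : widen_ord (leqnSn n) i = lift ord_max i.
  by apply: val_inj; rewrite [RHS]lift_max.
rewrite big_ord_recr /= !ffunE unlift_none mulrC; congr (_ * _); last first.
  rewrite big_pred0 ?addn0 // => t; apply/negP.
  by apply/negP; rewrite -leqNgt -ltnS.
apply: eq_bigr => s _; rewrite ffunE widenE liftK.
congr (w _ _ _); rewrite [in RHS]big_mkcond [in RHS]big_ord_recr /= ffunE unlift_none ltn_ord.
rewrite -addnA [(j + _)%N]addnC; congr (_ + (_ + _))%N.
rewrite [LHS]big_mkcond; apply: eq_bigr => t _.
by rewrite ffunE widenE liftK.
Qed.

Lemma fcoef_chain_prod (c : nat -> rat) k n N K : (N < K)%N ->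
  fcoef (chain_prod c n ^+ k) N =
  \sum_(l : {ffun 'I_n -> 'I_K} | (\sum_i l i)%N == N)
     \prod_(s < n) (binz ((-1) ^+ s.+1 * k%:Z - (\sum_(t < n | (s < t)%N) l t)%:Z)
                         (l s) * c s ^+ l s).
Proof.
(* The exponent -T of the last linear polynomial records the total of the variables already
   extracted. *)
pose G m T M := fcoef (chain_prod c m ^+ k * chain c m ^ (- T%:Z)) M.
pose w s T j := binz ((-1) ^+ s.+1 * k%:Z - T%:Z) j * c s ^+ j.
move=> lt_NK; transitivity (G n 0%N N); first by rewrite /G expr0z mulr1.
rewrite (@iterated_sum_ffun _ w G K) // => [T M|m T M].
  rewrite /G /chain_prod /chain !big_ord0 rmorph0 mulr0 addr0 expr1n exp1rz mulr1.
  exact: fcoef1.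
rewrite /G fcoef_chain_prodS; apply: eq_bigr => j _.
by rewrite /w PoszD opprD.
Qed.

(** * The algebraic system of the staircase *)

(** Positions and indices start at 0: the order is 0, r - 1, 1, r - 2, and so on. *)
Definition zigzag r s : nat := (if odd s then r - (s./2).+1 else s./2)%N.

Section Staircase.
Variables (r : nat) (a : nat -> rat) (U : nat -> fps rat).
Hypotheses (U0 : U 0%N = 1) (U_coef0 : forall m, fcoef (U m) 0 = 1).
Hypothesis US : forall m, (m < r)%N -> (U m - U m.+1) * U (r - m)%N = fX * fC (a m).

Let UU m : U m \is a GRing.unit. Proof. exact: fps_unit_coef0. Qed.
Let c s := (-1) ^+ s.+1 * a (zigzag r s).
Let M s := U (uphalf s) * U (r - s./2)%N.

Let half_cases s :
  (exists2 i, s = i.*2 & (odd s = false) /\ (s./2 = i) /\ uphalf s = i) \/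
  (exists2 i, s = i.*2.+1 & (odd s = true) /\ (s./2 = i) /\ uphalf s = i.+1).
Proof.
rewrite -[s]odd_double_half; case: (odd s); [right|left]; exists s./2 => //;
  by rewrite ?add1n ?add0n /= ?odd_double ?doubleK ?uphalf_double.
Qed.

(** An even step raises the index of the first factor, so [US] subtracts a term; an odd step lowers
    that of the second, so [US] adds one. Hence the sign in [c]. *)
Let M_step s : (s < r)%N -> M s.+1 = M s + fX * fC (c s).
Proof.
move=> lt_sr; rewrite /M /c /zigzag uphalfE -[s.+1./2]uphalfE /=.
case: (half_cases s) => -[i def_s [-> [-> ->]]].
  have lt_ir : (i < r)%N by lia.
  rewrite -signr_odd def_s /= odd_double /= mulN1r rmorphN mulrN -US //; ring.
have lt_ir : (r - i.+1 < r)%N by lia.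
rewrite -signr_odd def_s /= odd_double /= mul1r -US // subKn; last by lia.
by rewrite (_ : (r - i.+1).+1 = (r - i)%N); [ring | lia].
Qed.

(** The substitution turns U_r L_s into U_r + d_s X, while [M] starts at U_0 U_r = U_r and grows by
    the same increments. *)
Let fcomp_chain s : (s <= r)%N -> U r * fcomp (U r)^-1 (chain c s) = M s.
Proof.
have -> : U r * fcomp (U r)^-1 (chain c s) = U r + fX * fC (\sum_(i < s) c i).
  rewrite /chain rmorphD rmorph1 rmorphM /= fcomp_polyX fcompC.
  by rewrite mulrDr mulr1 !mulrA [U r * fX]mulrC mulrK.
elim: s => [|s IH] lt_sr.
  by rewrite big_ord0 rmorph0 mulr0 addr0 /M U0 mul1r subn0.
by rewrite M_step // -IH ?(ltnW lt_sr) // big_ord_recr rmorphD mulrDr addrA.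
Qed.

Let fcomp_quot s : (s < r)%N ->
  fcomp (U r)^-1 (chain c s.+1 / chain c s) * M s = M s.+1.
Proof.
move=> lt_sr; rewrite -!fcomp_chain ?(ltnW lt_sr) // mulrCA -rmorphM.
by rewrite mulrVK ?chain_unit.
Qed.

(** M_(s+1) / M_s reduces to a quotient of two neighbouring U's. Even steps, being inverted,
    telescope in U_(uphalf n); odd steps telescope in U_(r - n/2). *)
Let fcomp_chain_prod n : (n <= r)%N ->
  fcomp (U r)^-1 (chain_prod c n) * (U (uphalf n) * U r) = U (r - n./2)%N.
Proof.
elim: n => [|n IH] lt_nr.
  by rewrite /chain_prod big_ord0 rmorph1 U0 !mul1r subn0.
have quotU : chain c n.+1 / chain c n \is a GRing.unit.
  by rewrite unitrMl ?unitrV chain_unit.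
have := fcomp_quot lt_nr; move/(_ (ltnW lt_nr)): IH.
set P := fcomp _ (chain_prod c n); set q := fcomp _ (_ / _).
have -> : fcomp (U r)^-1 (chain_prod c n.+1) = P * q ^ ((-1) ^+ n.+1 : int).
  by rewrite {1}/chain_prod big_ord_recr rmorphM /= (rmorphXz (fcomp _)).
have qU : q \is a GRing.unit by rewrite rmorph_unit.
rewrite /M uphalfE -[n.+1./2]uphalfE /=.
case: (half_cases n) => -[i def_n [_ [-> ->]]] IH.
  rewrite !mulrA => /(mulIr (UU _)) qE.
  rewrite -signr_odd def_n /= odd_double /= expr1 exprN1 -IH -qE.
  by rewrite !mulrA mulrVK // -qE; ring.
rewrite [RHS]mulrC mulrCA [RHS]mulrC => /(mulrI (UU _)) qE.
rewrite -signr_odd def_n /= odd_double /= expr0 expr1z -qE -IH; ring.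
Qed.

Lemma staircase_system_coef k :
  k%:R * fcoef (U r) k.+1 = - fcoef (chain_prod c r ^+ k) k.+1.
Proof.
apply: lagrange_inversion => //.
(* At n = r the two indices meet, r - r/2 = uphalf r, so this factor cancels. *)
apply: (mulrI (UU (uphalf r))); rewrite mulr1 mulrA mulrC.
rewrite fcomp_chain_prod // (_ : (r - r./2)%N = uphalf r) //.
by rewrite uphalf_half -{1}[r]odd_double_half -addnn addnA addnK.
Qed.

End Staircase.

(** * Counting trees *)

Section Forests.
Variables (L : finType) (e : rel L).
Local Open Scope nat_scope.

(* h is a recursion bound; all forests with n vertices are listed when n < h. *)
Fixpoint forests (h n : nat) (x : L) : seq (seq (ltree L)) :=
  if h is g.+1 then
    if n is m.+1 then
      [seq Node z.1 tu.1 :: tu.2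
        | z <- [seq (y, i) | y <- enum (e x), i <- iota 0 m.+1],
          tu <- [seq (ts, us) | ts <- forests g z.2 z.1, us <- forests g (m - z.2) x]]
    else [:: [::]]
  else [::].

Lemma forestsS h n x : forests h.+1 n.+1 x =
  [seq Node z.1 tu.1 :: tu.2
    | z <- [seq (y, i) | y <- enum (e x), i <- iota 0 n.+1],
      tu <- [seq (ts, us) | ts <- forests h z.2 z.1, us <- forests h (n - z.2) x]].
Proof. by []. Qed.

Definition edge_ok (t : ltree L) : bool := all (fun p => e p.1 p.2) (edge_labels t).

Lemma edge_ok_cons x y ts us :
  edge_ok (Node x (Node y ts :: us)) = [&& e x y, edge_ok (Node y ts) & edge_ok (Node x us)].
Proof. by rewrite /edge_ok /= all_cat. Qed.

(** The label x belongs to the common parent of the roots, which is not counted among the n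
    vertices; hence the test on [Node x us]. *)
Lemma mem_forests h n x us : n < h ->
  (us \in forests h n x) =
  (sumn (map (@nvertices L) us) == n) && edge_ok (Node x us).
Proof.
elim: h n x us => // h IH [|n] x us lt_nh.
  by case: us => [|[y ts] us] //=; rewrite mem_seq1.
rewrite forestsS; apply/allpairsPdep/idP => [[[y m] [[ts us'] [/allpairsP[[y' m'] []]]]]|].
  rewrite mem_enum mem_iota /= => exy lt_mn [-> ->] /allpairsP[[ts' us''] /= []].
  rewrite !IH; try lia.
  move=> /andP[/eqP ts_m okts] /andP[/eqP us_m okus] [-> ->] ->.
  rewrite edge_ok_cons okts okus /= ts_m us_m; rewrite -topredE /= in exy; rewrite exy.
  by rewrite addSn subnKC ?eqxx // -ltnS.
case: us => [|[y ts] us]; first by rewrite andbC.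
rewrite edge_ok_cons [sumn _]/= addSn eqSS => /and4P[/eqP def_n exy okts okus].
exists (y, sumn (map (@nvertices L) ts)), (ts, us); split=> //.
  apply/allpairsP; exists (y, sumn (map (@nvertices L) ts)); rewrite mem_enum mem_iota.
  by split=> //; rewrite [X in X < _]/= add0n ltnS -def_n leq_addr.
apply/allpairsP; exists (ts, us); rewrite /=.
have le_us : sumn (map (@nvertices L) us) <= n by rewrite -def_n leq_addl.
have le_ts : sumn (map (@nvertices L) ts) <= n by rewrite -def_n leq_addr.
rewrite -def_n addKn !IH ?eqxx ?okts //.
  exact: leq_ltn_trans le_us lt_nh.
exact: leq_ltn_trans le_ts lt_nh.
Qed.

Lemma uniq_forests h n x : n < h -> uniq (forests h n x).
Proof.
elim: h n x => // h IH [|n] x lt_nh //; rewrite forestsS.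
apply: allpairs_uniq_dep => [|[y m]|].
- apply: allpairs_uniq; rewrite ?enum_uniq ?iota_uniq // => -[? ?] [? ?] _ _ [-> ->] //.
- case/allpairsP=> -[y' m'] [_]; rewrite mem_iota /= => lt_mn [-> ->].
  by apply: allpairs_uniq => [||[? ?] [? ?] _ _ [-> ->]] //; apply: IH; lia.
set st := (X in {in X &, _}).
(* The built forest no longer shows the size m in the index pair; m is recovered as the number of
   vertices of [ts], which yields injectivity. *)
have size_ts p : p \in st -> sumn (map (@nvertices L) (tagged p).1) = (tag p).2.
  case/allpairsPdep=> -[y m] [[ts us] [/allpairsP[[y' m'] []]]].
  rewrite mem_iota /= => _ lt_mn [-> ->] /allpairsP[[ts' us'] /= []].
  rewrite mem_forests; last by lia.
  by case/andP => /eqP ts_m _ _ [-> _] ->.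
move=> p q /size_ts + /size_ts; case: p q => [[y m] [ts us]] [[y' m'] [ts' us']] /=.
by move=> <- <- [-> -> ->].
Qed.

Definition nforests n x := size (forests n.+1 n x).

Lemma size_forests h n x : n < h -> size (forests h n x) = nforests n x.
Proof.
move=> lt_nh; apply/perm_size/uniq_perm; rewrite ?uniq_forests // => us.
by rewrite !mem_forests.
Qed.

Lemma nforestsS n x :
  nforests n.+1 x = \sum_(y | e x y) \sum_(m < n.+1) nforests m y * nforests (n - m) x.
Proof.
rewrite /nforests forestsS size_allpairs_dep sumnE big_map.
rewrite big_allpairs_dep big_enum; apply: eq_bigr => y _.
rewrite -[iota 0 n.+1]/(index_iota 0 n.+1) big_mkord; apply: eq_bigr => m _.
by rewrite size_allpairs [in LHS]size_forests ?ltn_ord // [in LHS]size_forests // ltnS leq_subr.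
Qed.

End Forests.

Section ForestSeries.
Variables (L : finType) (e : rel L).

Definition forest_series x : fps rat := Fps (fun n => (nforests e n x)%:R).

(** A forest is empty or a first tree followed by a forest under the same parent label. *)
Lemma forest_seriesE x :
  forest_series x * (1 - fX * \sum_(y | e x y) forest_series y) = 1.
Proof.
suff def_x : forest_series x =
    1 + fX * \sum_(y | e x y) forest_series y * forest_series x.
  apply/eqP; rewrite mulrBr mulr1 mulrCA subr_eq [X in X == _]def_x; apply/eqP.
  by rewrite -mulr_suml [X in fX * X]mulrC.
apply: fpsP => -[|n]; rewrite fcoefD fcoef1 fcoefXM ?addr0 // add0r fcoef_sum.
rewrite {1}/fcoef /= nforestsS natr_sum; apply: eq_bigr => y _.
by rewrite fcoefM natr_sum; apply: eq_bigr => m _; rewrite natrM.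
Qed.

End ForestSeries.

Lemma card_lambda_plane_tree lam n :
  #|{: lambda_plane_tree lam n.+1}| =
  (\sum_x nforests (fun i j => @compatible lam i j && compatible j i) n x)%N.
Proof.
pose e : rel 'I_(size lam) := fun i j => compatible i j && compatible j i.
transitivity (size [seq Node x ts | x <- enum 'I_(size lam), ts <- forests e n.+1 n x]).
  rewrite cardT -(size_map val); apply/perm_size/uniq_perm.
  - by rewrite map_inj_uniq; [exact: enum_uniq | exact: val_inj].
  - apply: allpairs_uniq_dep; first exact: enum_uniq.
      by move=> x _; apply: uniq_forests.
    by move=> [x ts] [y us] _ _ /= [-> ->].
  move=> t; apply/mapP/allpairsPdep => [[u _ ->]|[x [ts [_ + ->]]]].
    case: u => -[x ts] okt; exists x, ts.
    by split; rewrite ?mem_enum // mem_forests // -eqSS.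
  rewrite mem_forests // -eqSS => okt.
  pose u : lambda_plane_tree lam n.+1 := exist _ (Node x ts) okt.
  by exists u; first exact: mem_enum.
by rewrite size_allpairs_dep sumnE big_map big_enum.
Qed.

(** * Blocks of labels and their generating series *)

Section StaircaseLabels.
Variables (r : nat) (a : 'I_r -> nat).
Local Notation lam := (staircase a).

Lemma size_staircase : size lam = sum_le a r.
Proof.
rewrite size_flatten /shape -map_comp sumnE big_map big_enum /= /sum_le.
by apply: eq_big => [i|i _]; rewrite /= ?ltn_ord // size_nseq.
Qed.

Lemma sum_leS (i : 'I_r) : sum_le a i.+1 = (sum_le a i + a i)%N.
Proof.
rewrite /sum_le (bigD1 i) //= addnC; congr (_ + _)%N; apply: eq_bigl => j.
by rewrite ltnS ltn_neqAle andbC.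
Qed.

Let e (x y : 'I_(size lam)) := compatible x y && compatible y x.

(** Self-conjugacy merges the two directions of [e]. A witness j of [staircaseP] cannot be below i,
    since x lies past the first i blocks, so its bound on y is at most the one given by i. *)
Lemma compatible_block (i : 'I_r) (x y : 'I_(size lam)) :
  (sum_le a i <= x < sum_le a i.+1)%N -> e x y = (y < sum_le a (r - i))%N.
Proof.
case/andP=> le_ix lt_xi; rewrite /e /compatible.
rewrite (staircase_self_conjugate a y.+1 x.+1) andbb unfold_in /=.
apply/staircaseP/idP => [[j [lt_jr lt_xj lt_yj]]|lt_y]; last by exists i.
apply: leq_trans lt_yj _; apply: leq_sum_le; apply: leq_sub2l.
rewrite leqNgt; apply/negP => lt_ji.
by have := leq_trans lt_xj (leq_trans (leq_sum_le a lt_ji) le_ix); rewrite ltnn.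
Qed.

(** The series U_m: X times [forest_series e y] counts the trees whose root is labelled y. *)
Definition block_series m : fps rat :=
  1 - fX * \sum_(y : 'I_(size lam) | (y < sum_le a m)%N) forest_series e y.

Lemma block_series0 : block_series 0 = 1.
Proof.
rewrite /block_series big_pred0 ?mulr0 ?subr0 // => y.
by rewrite /sum_le big_pred0.
Qed.

Lemma fcoef_block_series0 m : fcoef (block_series m) 0 = 1.
Proof. by rewrite /block_series fcoefB fcoefXM fcoef1 subr0. Qed.

Lemma sum_block (V : nmodType) (i : 'I_r) (F : 'I_(size lam) -> V) :
  \sum_(y : 'I_(size lam) | (y < sum_le a i.+1)%N) F y =
  \sum_(y : 'I_(size lam) | (y < sum_le a i)%N) F y +
  \sum_(y : 'I_(size lam) | (sum_le a i <= y < sum_le a i.+1)%N) F y.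
Proof.
rewrite (bigID (fun y : 'I__ => y < sum_le a i)%N) /=.
congr (_ + _); apply: eq_bigl => y; last by rewrite -leqNgt andbC.
by rewrite andbC andb_idr // => /leq_trans; apply; apply: leq_sum_le.
Qed.

(** The difference is X times the sum of the forest series over block i, and U_(r-i) is the inverse
    of each of them by [forest_seriesE]; what remains is the size of the block. *)
Lemma block_seriesS (i : 'I_r) :
  (block_series i - block_series i.+1) * block_series (r - i) = fX * fC (a i)%:R.
Proof.
have -> : block_series i - block_series i.+1 =
    fX * \sum_(y : 'I_(size lam) | (sum_le a i <= y < sum_le a i.+1)%N) forest_series e y.
  by rewrite /block_series sum_block mulrDr; ring.
rewrite -mulrA mulr_suml (eq_bigr (fun=> 1)) => [|x x_i]; last first.
  rewrite -[RHS](forest_seriesE e x) /block_series.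
  by congr (_ * (1 - _ * _)); apply: eq_bigl => y; rewrite (compatible_block _ x_i).
congr (_ * _); rewrite rmorph_nat.
have count m : (m <= r)%N ->
    \sum_(y : 'I_(size lam) | (y < sum_le a m)%N) 1 = (sum_le a m)%:R :> fps rat.
  move=> le_mr; rewrite -(big_ord_widen _ (fun=> 1)) ?sumr_const ?card_ord //.
  by rewrite size_staircase leq_sum_le.
(* Splitting the constant sum gives the block size as a difference of two counts. *)
have := sum_block i (fun=> 1 : fps rat).
by rewrite !count ?(ltnW (ltn_ord i)) // sum_leS natrD => /addrI.
Qed.

Lemma card_staircase_trees k :
  #|{: lambda_plane_tree lam k.+1}|%:R = - fcoef (block_series r) k.+1.
Proof.
rewrite card_lambda_plane_tree /block_series fcoefB fcoef1 fcoefXM sub0r opprK.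
rewrite fcoef_sum natr_sum; apply: eq_bigl => y.
by rewrite -size_staircase ltn_ord.
Qed.

End StaircaseLabels.

(** * Partial sums and signs along the zigzag order *)

Section Zigzag.
Variable r : nat.

Lemma zigzag_ltn s : (s < r)%N -> (zigzag r s < r)%N.
Proof. by rewrite /zigzag; case: ifP => odd_s lt_sr; lia. Qed.

Definition zigzag_ord (s : 'I_r) : 'I_r := Ordinal (zigzag_ltn (ltn_ord s)).

Lemma zigzag_ord_bij : bijective zigzag_ord.
Proof.
apply: injF_bij => s t /(congr1 val) /= eq_st; apply: val_inj => /=.
have := ltn_ord s; have := ltn_ord t; move: eq_st; rewrite /zigzag.
by case: ifP => odd_s; case: ifP => odd_t; lia.
Qed.

(** The two ranges together cover each index visited before s once and every other index twice. *)
Lemma zigzag_sums_even (l : 'I_r -> nat) (s : 'I_r) : ~~ odd s ->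
  (sum_ge l (zigzag r s).+1 + sum_le l (r - (zigzag r s).+1 + 1) =
   \sum_i l i + (l (zigzag_ord s) + \sum_(t < r | s < t) l (zigzag_ord t)))%N.
Proof.
move=> even_s; have zb P := onW_bij P zigzag_ord_bij.
have -> : (l (zigzag_ord s) + \sum_(t < r | s < t) l (zigzag_ord t) =
           \sum_(t < r | s <= t) l (zigzag_ord t))%N.
  rewrite [RHS](bigD1 s) //=; congr (_ + _)%N; apply: eq_bigl => t.
  by rewrite ltn_neqAle andbC eq_sym.
rewrite /sum_ge /sum_le [X in (X + _ = _)%N](reindex zigzag_ord (zb _)).
rewrite [X in (_ + X = _)%N](reindex zigzag_ord (zb _)).
rewrite [X in (_ = X + _)%N](reindex zigzag_ord (zb _)) /=.
rewrite big_mkcond [X in (_ + X = _)%N]big_mkcond [X in (_ = _ + X)%N]big_mkcond.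
rewrite -!big_split.
apply: eq_bigr => t _ /=; have := ltn_ord t; have := ltn_ord s.
move: even_s; rewrite /zigzag => even_s ? ?.
by rewrite (negbTE even_s); case: (boolP (odd t)) => odd_t; do 3! case: ifP => ?; lia.
Qed.

(** Here the two ranges are disjoint and cover exactly the indices visited up to s. *)
Lemma zigzag_sums_odd (l : 'I_r -> nat) (s : 'I_r) : odd s ->
  (sum_ge l (zigzag r s).+1 + sum_le l (r - (zigzag r s).+1 + 1) +
   \sum_(t < r | s < t) l (zigzag_ord t) = \sum_i l i)%N.
Proof.
move=> odd_s; have zb P := onW_bij P zigzag_ord_bij.
rewrite /sum_ge /sum_le [X in (X + _ + _ = _)%N](reindex zigzag_ord (zb _)).
rewrite [X in (_ + X + _ = _)%N](reindex zigzag_ord (zb _)).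
rewrite [X in (_ = X)%N](reindex zigzag_ord (zb _)) /=.
rewrite big_mkcond [X in (_ + X + _ = _)%N]big_mkcond [X in (_ + X = _)%N]big_mkcond.
rewrite -!big_split.
apply: eq_bigr => t _ /=; have := ltn_ord t; have := ltn_ord s.
move: odd_s; rewrite /zigzag => odd_s ? ?.
by rewrite odd_s; case: (boolP (odd t)) => odd_t; do 3! case: ifP => ?; lia.
Qed.

Lemma eps_zigzag s : (s < r)%N -> eps r (zigzag r s).+1 = ~~ odd s.
Proof. by rewrite /eps /zigzag => lt_sr; case: ifP => odd_s; congr nat_of_bool; lia. Qed.

End Zigzag.

(** At odd positions the upper arguments agree directly. At even positions upper negation applies:
    its sign cancels that of (-x)^l, and its shift by l - 1 accounts for the l in [zigzag_sums_even]
    and for the -1 from [eps]. *)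
Lemma zigzag_factor r k (l : 'I_r -> nat) (s : 'I_r) (x : rat) :
  (\sum_i l i)%N = k.+1 -> 
  binz ((-1) ^+ s.+1 * k%:Z - (\sum_(t < r | (s < t)%N) l (zigzag_ord t))%:Z)
       (l (zigzag_ord s)) * ((-1) ^+ s.+1 * x) ^+ l (zigzag_ord s) =
  binz ((sum_ge l (zigzag r s).+1)%:Z + (sum_le l (r - (zigzag r s).+1 + 1))%:Z
          - 1 - (eps r (zigzag r s).+1)%:Z) (l (zigzag_ord s))
    * x ^+ l (zigzag_ord s).
Proof.
move=> sum_l; rewrite eps_zigzag // exprMn mulrA; congr (_ * _).
rewrite -PoszD -[(-1) ^+ s.+1]signr_odd -[(-1) ^+ s.+1]signr_odd /=.
case odd_s: (odd s) => /=.
  rewrite expr0 expr1n mulr1 mul1r; congr binz.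
  have := zigzag_sums_odd l odd_s; rewrite sum_l subr0.
  by move: (sum_ge _ _ + sum_le _ _)%N (\sum_(t < r | _) _)%N => p q; lia.
rewrite expr1 mulN1r -opprD binzN mulrAC -exprMn mulrNN mulr1 expr1n mul1r.
congr binz; rewrite (zigzag_sums_even l (negbT odd_s)) sum_l.
by move: (l _) (\sum_(t < r | _) _)%N => p q; lia.
Qed.

(* Each l_i is at most k + 1, so 'I_(k.+2) is a sufficient range for it. *)
Theorem theorem3p5 (r : nat) (hr : (1 <= r)%N)
    (a : 'I_r -> nat) (ha : forall i, (0 < a i)%N)
    (k : nat) (hk : (1 <= k)%N) :
  #|{: lambda_plane_tree (staircase a) k.+1}|%:R =
  \sum_(l : {ffun 'I_r -> 'I_k.+2} | (\sum_(i < r) l i)%N == k.+1)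
     tcoef k (fun i => l i : nat) * \prod_(i < r) (a i)%:R ^+ l i :> rat.
Proof.
pose A m : rat := if insub m is Some i then (a i)%:R else 0.
have A_ord (i : 'I_r) : A i = (a i)%:R by rewrite /A valK.
have US m : (m < r)%N -> (block_series a m - block_series a m.+1) * block_series a (r - m)
    = fX * fC (A m).
  by move=> lt_mr; rewrite (block_seriesS a (Ordinal lt_mr)) -A_ord.
have k_neq0 : k%:R != 0 :> rat by rewrite pnatr_eq0 -lt0n.
have := staircase_system_coef (block_series0 a) (fcoef_block_series0 a) US k.
move/(canRL (mulKf k_neq0)).
rewrite card_staircase_trees => ->; rewrite mulrN opprK.
rewrite (fcoef_chain_prod _ _ _ (ltnSn k.+1)) mulr_sumr.
have zb := zigzag_ord_bij r; have [z' zK z'K] := zb.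
have zbT := onW_bij predT zb.
(* The expansion indexes the variables by zigzag position, the theorem by block; [h] translates
   between the two. *)
pose h (l : {ffun 'I_r -> 'I_k.+2}) : {ffun 'I_r -> 'I_k.+2} := [ffun s => l (zigzag_ord s)].
rewrite (reindex h) /=; last first.
  exists (fun l => [ffun i => l (z' i)]) => l _; apply/ffunP => i;
    by rewrite !ffunE ?zK ?z'K.
have sum_h (l : {ffun 'I_r -> 'I_k.+2}) : (\sum_i h l i = \sum_i l i)%N.
  by rewrite [RHS](reindex (@zigzag_ord r) zbT); apply: eq_bigr => s _; rewrite ffunE.
apply: eq_big => [l|l /eqP]; first by rewrite sum_h.
rewrite sum_h => sum_l; rewrite /tcoef -mulrA -big_split; congr (_ * _).
rewrite [RHS](reindex (@zigzag_ord r) zbT); apply: eq_bigr => s _ /=.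
rewrite -A_ord -(zigzag_factor _ _ sum_l) ffunE.
under eq_bigr => t _ do rewrite ffunE.
by [].
Qed.
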